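(* Let $(\mathcal G(A,D),p,\mathcal V_a)$ be a sensor network in $\mathbb R^2$ such that (i) the SA index set $\mathcal T_A$ is connected over $\mathcal G$; (ii) the network $(\mathcal G(A,D),p,\mathcal V_a)$ is SA-RoD localizable; (iii) there exist two anchors $i,j\in\mathcal V_a$ with $(i,j)\in\mathcal E$. Implement protocol (E1) in the first stage and protocol (E2) in the second stage. Then $\hat b_{ij}$, $\hat d_{ij}$, $\hat x_i$ converge exponentially to the true bearings $b_{ij}$, true distances $d_{ij}$ and true locations $p_i$, respectively, for all free nodes $i\in\mathcal V_f$, under any initial estimates $\hat x_i(0)$, $\hat b_{ij}(0)$, $\hat d_{ij}(0)>0$.
   Context: Sensor network: $\mathcal V=\{1,\dots,n\}=\mathcal V_a\cup\mathcal V_f$ (anchors $\mathcal V_a=\{1,\dots,n_a\}$, free nodes $\mathcal V_f$), $n\ge3$; $\mathcal G=(\mathcal V,\mathcal E)$ is a connected simple undirected graph with neighbor sets $\mathcal N_i$ and a node bipartition $\mathcal V=\mathcal V_A\cup\mathcal V_D$ ($\mathcal V_A,\mathcal V_D$ disjoint and nonempty). True locations: $p=(p_1^\top,\dots,p_n^\top)^\top$, pairwise distinct $p_i\in\mathbb R^2$; $d_{ij}=\|p_j-p_i\|$, $b_{ij}=(p_j-p_i)/d_{ij}$. $\mathcal R(\theta)$ is the counter-clockwise rotation matrix. $\mathcal T_A=\{(u,v,w)\in\mathcal V^3:u\in\mathcal V_A,(u,v),(u,w)\in\mathcal E,v<w\}$; $\mathcal T_D$ likewise with $u\in\mathcal V_D$.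 For $(i,j,k)\in\mathcal T_A$, $\theta_{ijk}\in[0,2\pi)$ is the counter-clockwise signed angle from $b_{ij}$ to $b_{ik}$; for $(i,j,k)\in\mathcal T_D$, $\kappa_{ijk}=d_{ik}/d_{ij}$. $\mathcal T_A$ is connected over $\mathcal G$ if the following graph is connected: its vertices are the edges of $\mathcal G$; edges $\{i,j\},\{i,k\}$ ($j\ne k$) are adjacent iff $(i,j,k)$ or $(i,k,j)$ is in $\mathcal T_A$. SA-RoD localizable: there is a unique $x\in\mathbb R^{2n}$ (with $x_i\neq x_j$ for $(i,j)\in\mathcal E$) such that $\frac{x_k-x_i}{\|x_k-x_i\|}=\mathcal R(\theta_{ijk})\frac{x_j-x_i}{\|x_j-x_i\|}$ for $(i,j,k)\in\mathcal T_A$, $\frac{\|x_t-x_r\|}{\|x_s-x_r\|}=\kappa_{rst}$ for $(r,s,t)\in\mathcal T_D$, and $x_i=p_i$ for $i\in\mathcal V_a$ (namely $x=p$). (E1) First stage: for each node $i$ and $j\in\mathcal N_i$ (not both anchors), $\dot{\hat b}_{ij}=-\Big[\sum_{(i,k,j)\in\mathcal T_A}(\hat b_{ij}-\mathcal R(\theta_{ikj})\hat b_{ik})+\sum_{(i,j,k)\in\mathcal T_A}(\hat b_{ij}-\mathcal R^\top(\theta_{ijk})\hat b_{ik})+\sum_{(j,k,i)\in\mathcal T_A}(\hat b_{ij}+\mathcal R(\theta_{jki})\hat b_{jk})+\sum_{(j,i,k)\in\mathcal T_A}(\hat b_{ij}+\mathcal R^\top(\theta_{jik})\hat b_{jk})\Big]$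 (sums over $k$), with $\hat b_{ij}\equiv b_{ij}$ if $i,j\in\mathcal V_a$. (E2) Second stage, with $b_{ij}$ the true bearings (the equilibrium of (E1)), one variable $\hat d_{ij}=\hat d_{ji}$ per edge: for $i\in\mathcal V_f$, $\dot{\hat x}_i=-\sum_{j\in\mathcal N_i}(\hat x_i-\hat x_j+\hat d_{ij}b_{ij})$; for $(i,j)\in\mathcal E$ not both anchors, $\dot{\hat d}_{ij}=-\hat d_{ij}+b_{ij}^\top(\hat x_j-\hat x_i)+\sum_{(i,j,k)\in\mathcal T_D}\kappa_{ijk}(\hat d_{ik}-\kappa_{ijk}\hat d_{ij})-\sum_{(i,k,j)\in\mathcal T_D}(\hat d_{ij}-\kappa_{ikj}\hat d_{ik})+\sum_{(j,i,k)\in\mathcal T_D}\kappa_{jik}(\hat d_{jk}-\kappa_{jik}\hat d_{ij})-\sum_{(j,k,i)\in\mathcal T_D}(\hat d_{ij}-\kappa_{jki}\hat d_{jk})$ (sums over $k$); with $\hat x_i\equiv p_i$ for $i\in\mathcal V_a$ and $\hat d_{ij}\equiv d_{ij}$ for $i,j\in\mathcal V_a$. Equivalently, (E2) is the gradient flow, in the non-fixed variables, of $V(\hat x,\hat d)=\frac12\big(\sum_{(i,j)\in\mathcal E}\|\hat x_j-\hat x_i-\hat d_{ij}b_{ij}\|^2+\sum_{(i,j,k)\in\mathcal T_D}(\hat d_{ik}-\kappa_{ijk}\hat d_{ij})^2\big)$. *)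

(* Defs.v *)
From HB Require Import structures.
From mathcomp Require Import all_boot all_order all_algebra.
From mathcomp Require Import all_classical all_reals all_analysis.
From mathcomp Require Import ring lra.

Set Implicit Arguments.
Unset Strict Implicit.
Unset Printing Implicit Defensive.

Import Order.TTheory GRing.Theory Num.Theory.
Import numFieldNormedType.Exports.

Local Open Scope ring_scope.

(* The library norm on matrices is the sup norm, hence an explicit Euclidean
   structure on the plane. *)
Definition dotp (R : realType) (u v : 'cV[R]_2) : R := (u^T *m v) 0 0.

Definition enorm (R : realType) (u : 'cV[R]_2) : R := Num.sqrt (dotp u u).

Definition bearing (R : realType) (x y : 'cV[R]_2) : 'cV[R]_2 :=
  (enorm (y - x))^-1 *: (y - x).

Definition rotmx (R : realType) (a : R) : 'M[R]_2 :=
  \matrix_(i < 2, j < 2)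
    (if i == j then cos a else if i == 0 then - sin a else sin a).

Definition cross (R : realType) (u v : 'cV[R]_2) : R :=
  u 0 0 * v 1 0 - u 1 0 * v 0 0.

(* Counter-clockwise angle, in [0, 2 pi), from the unit vector u to the unit
   vector v; ccw_angleP below is its characterization. *)
Definition ccw_angle (R : realType) (u v : 'cV[R]_2) : R :=
  if 0 <= cross u v then acos (dotp u v) else 2 * pi - acos (dotp u v).

Lemma dotpE (R : realType) (u v : 'cV[R]_2) :
  dotp u v = u 0 0 * v 0 0 + u 1 0 * v 1 0.
Proof.
rewrite /dotp !mxE big_ord_recl big_ord1 !mxE.
by congr (_ + u _ _ * v _ _); apply/val_inj.
Qed.

Lemma ccw_angleP (R : realType) (u v : 'cV[R]_2) :
  enorm u = 1 -> enorm v = 1 ->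
  0 <= ccw_angle u v < 2 * pi /\ v = rotmx (ccw_angle u v) *m u.
Proof.
have sq1 (w : 'cV[R]_2) : enorm w = 1 -> w 0 0 ^+ 2 + w 1 0 ^+ 2 = 1.
  move=> /(congr1 (fun r => r ^+ 2)); rewrite expr1n /enorm sqr_sqrtr dotpE.
    by rewrite -!expr2.
  by rewrite -!expr2 addr_ge0 ?sqr_ge0.
move=> /sq1 u1 /sq1 v1; set c := dotp u v; set s := cross u v.
have cs : c ^+ 2 + s ^+ 2 = 1.
  transitivity ((u 0 0 ^+ 2 + u 1 0 ^+ 2) * (v 0 0 ^+ 2 + v 1 0 ^+ 2)).
    by rewrite /c /s dotpE /cross; ring.
  by rewrite u1 v1 mulr1.
have cB : -1 <= c <= 1 by apply/andP; split; nra.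
have cK : cos (acos c) = c by case: (acos_def cB).
have a0 := acos_ge0 cB; have api := acos_lepi cB.
have pi0 : 0 < pi :> R := pi_gt0 R.
have sE : 1 - c ^+ 2 = s ^+ 2 by rewrite -cs; ring.
have [aB ccE ssE] : [/\ 0 <= ccw_angle u v < 2 * pi,
    cos (ccw_angle u v) = c & sin (ccw_angle u v) = s].
  rewrite /ccw_angle -/c -/s; have [s0|s0] := leP 0 s.
    split; [by apply/andP; split; lra | by [] |].
    by rewrite sin_acos ?sE ?sqrtr_sqr ?ger0_norm.
  have c1 : c < 1 by nra.
  have ap : 0 < acos c by apply: acos_gt0; case/andP: cB => ->.
  have E : 2 * pi - acos c = - acos c + pi *+ 2 by ring.
  split; first by apply/andP; split; lra.
    by rewrite E cosD2pi cosN.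
  by rewrite E sinD2pi sinN sin_acos // sE sqrtr_sqr ltr0_norm // opprK.
split=> //; apply/colP => i; rewrite !mxE big_ord_recl big_ord1 !mxE /= ccE ssE.
have -> : lift ord0 ord0 = 1 :> 'I_2 by apply/val_inj.
rewrite /c /s dotpE /cross.
have [->|i0] := eqVneq i 0; rewrite /=.
  rewrite -[LHS]mulr1 -u1; ring.
have -> : i = 1 by case: i i0 => [[|[|]]] // ? ?; apply/val_inj.
by rewrite /= -[LHS]mulr1 -u1; ring.
Qed.

(* Node k of {1, ..., n} is the ordinal k - 1; the anchors are {1, ..., na}. *)
Record sensor_network (R : realType) (n na : nat) := SensorNetwork {
  n_ge3 : (3 <= n)%N;
  na_le : (na <= n)%N;
  edge : rel 'I_n;
  edge_sym : symmetric edge;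
  edge_irr : irreflexive edge;
  edge_connected : forall i j, connect edge i j;
  VA : {set 'I_n};
  VD : {set 'I_n};
  VA_VD_cover : VA :|: VD = [set: 'I_n];
  VA_VD_disjoint : [disjoint VA & VD];
  VA_neq0 : VA != finset.set0;
  VD_neq0 : VD != finset.set0;
  pos : 'I_n -> 'cV[R]_2;
  pos_inj : injective pos
}.

Section Network.
Variables (R : realType) (n na : nat) (N : sensor_network R n na).
Implicit Types (i j k : 'I_n).

Definition anchor i : bool := (i < na)%N.
Definition free_node i : bool := ~~ anchor i.

Definition dist i j : R := enorm (pos N j - pos N i).
Definition bear i j : 'cV[R]_2 := bearing (pos N i) (pos N j).

Definition TA i j k : bool :=
  [&& i \in VA N, edge N i j, edge N i k & (j < k)%N].
Definition TD i j k : bool :=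
  [&& i \in VD N, edge N i j, edge N i k & (j < k)%N].

Definition theta i j k : R := ccw_angle (bear i j) (bear i k).
Definition kappa i j k : R := dist i k / dist i j.

Definition edge_set : {set {set 'I_n}} :=
  [set e : {set 'I_n} | [exists i, exists j, edge N i j && (e == [set i; j])]].

Definition TA_adj : rel {set 'I_n} := fun e f =>
  [exists i, exists j, exists k,
    [&& j != k, e == [set i; j], f == [set i; k] & TA i j k || TA i k j]].

Definition TA_connected : Prop :=
  {in edge_set &, forall e f, connect TA_adj e f}.

Definition SA_RoD_solution (x : 'I_n -> 'cV[R]_2) : Prop :=
  [/\ forall i j, edge N i j -> x i <> x j,
      forall i j k, TA i j k ->
        bearing (x i) (x k) = rotmx (theta i j k) *m bearing (x i) (x j),
      forall r s t, TD r s t ->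
        enorm (x t - x r) / enorm (x s - x r) = kappa r s t
    & forall i, anchor i -> x i = pos N i].

Definition SA_RoD_localizable : Prop :=
  exists! x : 'I_n -> 'cV[R]_2, SA_RoD_solution x.

Definition E1_rhs (b : 'I_n -> 'I_n -> 'cV[R]_2) i j : 'cV[R]_2 :=
  - (\sum_(k | TA i k j) (b i j - rotmx (theta i k j) *m b i k)
     + \sum_(k | TA i j k) (b i j - (rotmx (theta i j k))^T *m b i k)
     + \sum_(k | TA j k i) (b i j + rotmx (theta j k i) *m b j k)
     + \sum_(k | TA j i k) (b i j + (rotmx (theta j i k))^T *m b j k)).

Definition E2_rhs_x (x : 'I_n -> 'cV[R]_2) (d : 'I_n -> 'I_n -> R) i
    : 'cV[R]_2 :=
  - \sum_(j | edge N i j) (x i - x j + d i j *: bear i j).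

Definition E2_rhs_d (x : 'I_n -> 'cV[R]_2) (d : 'I_n -> 'I_n -> R) i j : R :=
  - d i j + dotp (bear i j) (x j - x i)
  + \sum_(k | TD i j k) kappa i j k * (d i k - kappa i j k * d i j)
  - \sum_(k | TD i k j) (d i j - kappa i k j * d i k)
  + \sum_(k | TD j i k) kappa j i k * (d j k - kappa j i k * d i j)
  - \sum_(k | TD j k i) (d i j - kappa j k i * d j k).

(* No condition on f at negative times: the derivative at 0 is only one-sided. *)
Definition evolves (V : normedModType R) (f g : R -> V) : Prop :=
  {within [set t : R | 0 <= t], continuous f}%classic /\
  (forall t : R, 0 < t -> is_derive t 1 f (g t)).

(* b i j and b j i are separate estimates, held by the nodes i and j; estimates
   indexed by non-adjacent pairs are never used and left unconstrained. *)
Definition E1_trajectory (b : 'I_n -> 'I_n -> R -> 'cV[R]_2) : Prop :=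
  forall i j, edge N i j ->
    if anchor i && anchor j then forall t : R, 0 <= t -> b i j t = bear i j
    else evolves (b i j) (fun t => E1_rhs (fun k l => b k l t) i j).

Definition E2_trajectory (x : 'I_n -> R -> 'cV[R]_2) (d : 'I_n -> 'I_n -> R -> R)
    : Prop :=
  [/\ forall i j, edge N i j -> forall t : R, 0 <= t -> d i j t = d j i t,
      forall i,
        if anchor i then forall t : R, 0 <= t -> x i t = pos N i
        else evolves (x i)
               (fun t => E2_rhs_x (fun k => x k t) (fun k l => d k l t) i)
    & forall i j, edge N i j ->
        if anchor i && anchor j then forall t : R, 0 <= t -> d i j t = dist i j
        else evolves (d i j)
               (fun t => E2_rhs_d (fun k => x k t) (fun k l => d k l t) i j)].

Definition E1_error (b : 'I_n -> 'I_n -> 'cV[R]_2) : R :=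
  \sum_i \sum_(j | edge N i j) enorm (b i j - bear i j).

Definition E2_error (x : 'I_n -> 'cV[R]_2) (d : 'I_n -> 'I_n -> R) : R :=
  \sum_i enorm (x i - pos N i)
  + \sum_i \sum_(j | edge N i j) `|d i j - dist i j|.

End Network.

(* Main.v *)
(** First stage.  The errors [e a] of the bearing estimates, one for each ordered
    pair of neighbors, evolve by [e a' = - sum_b (e a - T_ab (e b))] with [T_ab]
    orthogonal, the sum being over the pairs coupled to [a]; they vanish on anchor
    pairs, and connectedness of the triples provides from every [a] a chain of
    couplings down to an anchor pair.  Hence there is a barrier [1 <= v <= 2] with
    [lam * v a < sum_b (v a - v b)] for all non-anchor [a], and by the maximum
    principle [max_a |e a| exp (lam t) / v a] does not increase.

    Second stage.  In error coordinates the flow is the gradient flow of the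
    quadratic form [V], so half the squared norm of the error decreases at rate
    [2 V].  A kernel vector of [V] shifts the true positions, keeping all bearings
    and distance ratios, to another solution of the localization problem; so
    localizability makes [V] positive definite, hence coercive. *)

Require Import Defs.
From HB Require Import structures.
From mathcomp Require Import all_boot all_order all_algebra.
From mathcomp Require Import all_classical all_reals all_analysis.
From mathcomp Require Import ring lra.

Set Implicit Arguments.
Unset Strict Implicit.
Unset Printing Implicit Defensive.

Import Order.TTheory GRing.Theory Num.Theory.
Import numFieldNormedType.Exports.

Local Open Scope classical_set_scope.
Local Open Scope ring_scope.

(** * Calculus along trajectories on the nonnegative half-line, and a maximum principle *)

Section Evolution.
Variable R : realType.
Implicit Types (f g : R -> R) (t a : R).

(** Agreement at nonnegative times suffices: near a positive time, the derivative sees positive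
    times only. *)
Lemma evolves_eq (V : normedModType R) (f f' g g' : R -> V) :
  (forall t, 0 <= t -> f t = f' t) -> (forall t, 0 < t -> g t = g' t) ->
  evolves f g -> evolves f' g'.
Proof.
move=> ff gg [fc fd]; split.
  apply: (@subspace_eq_continuous _ _ _ f) => //.
  by move=> t; rewrite inE /= => t0; exact: ff.
move=> t t0; rewrite -gg//; apply: near_eq_is_derive (fd t t0).
near=> s; apply: ff; apply/ltW; near: s; exact: lt_nbhsr.
Unshelve. all: by end_near. Qed.

Lemma evolves_cst (V : normedModType R) (c : V) :
  evolves (fun _ : R => c) (fun=> 0).
Proof.
split; first by apply: continuous_subspaceT => t; exact: cvg_cst.
by move=> t _; exact: is_derive_cst.
Qed.

Lemma evolvesB (V : normedModType R) (f g f' g' : R -> V) :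
  evolves f f' -> evolves g g' ->
  evolves (fun t => f t - g t) (fun t => f' t - g' t).
Proof.
move=> [fc fd] [gc gd]; split; first exact: within_continuousB.
by move=> t t0; have := fd t t0; have := gd t t0 => ? ?; exact: is_deriveB.
Qed.

Lemma evolvesD f g f' g' : evolves f f' -> evolves g g' ->
  evolves (fun t => f t + g t) (fun t => f' t + g' t).
Proof.
move=> [fc fd] [gc gd]; split; first exact: within_continuousD.
by move=> t t0; have := fd t t0; have := gd t t0 => ? ?; exact: is_deriveD.
Qed.

Lemma evolvesM f g f' g' : evolves f f' -> evolves g g' ->
  evolves (fun t => f t * g t) (fun t => f t * g' t + g t * f' t).
Proof.
move=> [fc fd] [gc gd]; split.
  by move=> t; apply: cvgM; [exact: fc|exact: gc].
by move=> t t0; have := fd t t0; have := gd t t0 => ? ?; exact: is_deriveM.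
Qed.

Lemma evolves_sum (I : finType) (P : pred I) (f g : I -> R -> R) :
  (forall i, P i -> evolves (f i) (g i)) ->
  evolves (fun t => \sum_(i | P i) f i t) (fun t => \sum_(i | P i) g i t).
Proof.
move=> fg; elim: (index_enum I) => [|i s IH].
  by apply: evolves_eq (evolves_cst 0) => t _; rewrite big_nil.
have [Pi|nPi] := boolP (P i); last first.
  by apply: evolves_eq IH => t _; rewrite big_cons (negbTE nPi).
by apply: evolves_eq (evolvesD (fg i Pi) IH) => t _; rewrite big_cons Pi.
Qed.

Lemma evolves_expR a : evolves (fun t => expR (a * t)) (fun t => a * expR (a * t)).
Proof.
have d t : is_derive t 1 (fun t => expR (a * t)) (a * expR (a * t)).
  have dl : is_derive t 1 ( *%R a) (a *: (1 : R)) by exact: is_deriveZ.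
  have /is_derive_eq : is_derive t 1 (expR \o ( *%R a)) (expR (a * t) * (a *: (1 : R))).
    exact: is_derive1_comp.
  apply; by rewrite /GRing.scale/= mulr1 mulrC.
split=> [|t _]; last exact: d.
apply: continuous_subspaceT => t.
by apply/differentiable_continuous/derivable1_diffP; case: (d t).
Qed.

Lemma evolves_coord (m n : nat) (f g : R -> 'M[R]_(m, n)) i j :
  evolves f g -> evolves (fun t => f t i j) (fun t => g t i j).
Proof.
move=> [fc fd]; split.
  by move=> t; exact: (cvg_comp _ _ (fc t) (@coord_continuous _ _ _ i j _)).
move=> t t0; have [df dE] := fd t t0.
split; first by move: df => /derivable_mxP; exact.
by rewrite -dE derive_mx// mxE.
Qed.

Lemma evolves_nincr f g : evolves f g -> (forall t, 0 < t -> g t <= 0) ->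
  forall t, 0 <= t -> f t <= f 0.
Proof.
move=> [fc fd] g0 t t0; apply: (@ler0_derive1_nincry _ f 0) => //.
- by move=> x; rewrite in_itv/= andbT => x0; have := fd x x0 => ?.
- move=> x; rewrite in_itv/= andbT => x0; rewrite derive1E.
  by have := fd x x0 => ?; rewrite derive_val g0.
- by apply: continuous_subspaceW fc => x /=; rewrite in_itv/= andbT.
Qed.

(** Difference quotients from the left are nonnegative at such a [t], and so is their limit. Later
    times do not enter, so [t] may be the right end of the interval on which [f] is maximized. *)
Lemma evolves_left_max f g t : evolves f g -> 0 < t ->
  (forall s, 0 <= s <= t -> f s <= f t) -> 0 <= g t.
Proof.
move=> [_ fd] t0 fmax; have [df dE] := fd t t0.
have /cvgrPdist_lt cv : h^-1 *: (f (h *: 1 + t) - f t) @[h --> 0^'] --> g t.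
  by rewrite -dE; exact: df.
rewrite leNgt; apply/negP => gt0.
have /cv[e/= e0 He] : 0 < - g t by rewrite oppr_gt0.
(* A negative increment, of size at most [e / 2] so that the quotient is close to [g t], and at most
   [t] so that [t + h] is not negative. *)
pose h := - Num.min (e / 2) t.
have m0 : 0 < Num.min (e / 2) t by rewrite lt_min t0 divr_gt0.
have h0 : h < 0 by rewrite oppr_lt0.
have : `|g t - h^-1 *: (f (h *: 1 + t) - f t)| < - g t.
  apply: He; last by rewrite lt_eqF.
  rewrite /= sub0r opprK gtr0_norm// (le_lt_trans (_ : _ <= e / 2))//.
    by rewrite ge_min lexx.
  by rewrite ltr_pdivrMr// ltr_pMr// ltr1n.
have q0 : 0 <= h^-1 *: (f (h *: 1 + t) - f t).
  rewrite /GRing.scale/= mulr1 -mulrNN mulr_ge0//.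
    by rewrite oppr_ge0 invr_le0 ltW.
  rewrite oppr_ge0 subr_le0; apply: fmax.
  have ht : - h <= t by rewrite opprK ge_min lexx orbT.
  by apply/andP; split; lra.
by rewrite ltr_norml => /andP[+ _]; lra.
Qed.

(** If some [f i] exceeded [M] at time [T], the largest value over all indices and all times in
    [[0, T]] would be reached at a positive time, the initial values being at most [M]. The
    derivative there is nonnegative by [evolves_left_max], yet negative by assumption. *)
Lemma maximum_principle (I : finType) (f g : I -> R -> R) (M : R) :
  0 <= M -> (forall i, evolves (f i) (g i)) -> (forall i, f i 0 <= M) ->
  (forall i t, 0 < t -> 0 < f i t -> (forall j, f j t <= f i t) -> g i t < 0) ->
  forall i t, 0 <= t -> f i t <= M.
Proof.
move=> M0 ev f0 neg i T T0; rewrite leNgt; apply/negP => fM.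
(* [c j] is a time at which [f j] is maximal on [[0, T]]; [k] below is an index with the largest of
   these maxima. *)
have /choice[c cP] : forall j, exists c, c \in `[0, T] /\
    forall t, t \in `[0, T] -> f j t <= f j c.
  move=> j; have [fc _] := ev j.
  have [|c] := @EVT_max _ (f j) 0 T T0; last by exists c.
  by apply: continuous_subspaceW fc => x /=; rewrite in_itv/= => /andP[].
have [k _ kmax] := @Order.TotalTheory.arg_maxP _ _ _ i xpredT (fun j => f j (c j)) isT.
have [cT cmax] := cP k.
have fkM : M < f k (c k).
  apply: lt_le_trans fM _; apply: le_trans (kmax i isT).
  by apply: (cP i).2; rewrite in_itv/= T0 lexx.
move: (cT); rewrite in_itv/= => /andP[c0 cTT].
have cgt0 : 0 < c k.
  rewrite lt_neqAle c0 andbT; apply/eqP => cE.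
  by move: fkM; rewrite -cE ltNge f0.
have : g k (c k) < 0.
  apply: neg => //; first exact: le_lt_trans fkM.
  by move=> j; apply: le_trans (kmax j isT); exact: (cP j).2.
apply/negP; rewrite -leNgt; apply: (@evolves_left_max (f k)) => // s /andP[s0 sc].
by apply: cmax; rewrite in_itv/= s0 (le_trans sc).
Qed.

End Evolution.

(** * Euclidean geometry of the plane: scalar product, bearings, rotations *)

Section Plane.
Variable R : realType.
Implicit Types (u v w : 'cV[R]_2) (a b M : R).

Lemma dotpDl u v w : dotp (u + v) w = dotp u w + dotp v w.
Proof. by rewrite !dotpE !mxE; ring. Qed.

Lemma dotpDr u v w : dotp w (u + v) = dotp w u + dotp w v.
Proof. by rewrite !dotpE !mxE; ring. Qed.

Lemma dotpNl u v : dotp (- u) v = - dotp u v.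
Proof. by rewrite !dotpE !mxE; ring. Qed.

Lemma dotpNr u v : dotp u (- v) = - dotp u v.
Proof. by rewrite !dotpE !mxE; ring. Qed.

Lemma dotpZl a u v : dotp (a *: u) v = a * dotp u v.
Proof. by rewrite !dotpE !mxE; ring. Qed.

Lemma dotpZr a u v : dotp u (a *: v) = a * dotp u v.
Proof. by rewrite !dotpE !mxE; ring. Qed.

Lemma dotpC u v : dotp u v = dotp v u.
Proof. by rewrite !dotpE; ring. Qed.

Lemma dotp0l u : dotp 0 u = 0.
Proof. by rewrite dotpE !mxE; ring. Qed.

Lemma dotp_sumr (I : finType) (P : pred I) u (F : I -> 'cV[R]_2) :
  dotp u (\sum_(i | P i) F i) = \sum_(i | P i) dotp u (F i).
Proof.
elim/big_rec2: _ => [|i x y _ <-]; first by rewrite dotpC dotp0l.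
by rewrite dotpDr.
Qed.

Lemma dotp_ge0 u : 0 <= dotp u u.
Proof. by rewrite dotpE -!expr2 addr_ge0 ?sqr_ge0. Qed.

Lemma dotp_eq0 u : dotp u u = 0 -> u = 0.
Proof.
rewrite dotpE -!expr2 => /eqP; rewrite paddr_eq0 ?sqr_ge0// !sqrf_eq0.
move=> /andP[/eqP u0 /eqP u1]; apply/colP => i; rewrite mxE.
by case: i => [[|[|//]] p]; [rewrite -[RHS]u0|rewrite -[RHS]u1]; congr (u _ _);
  apply/val_inj.
Qed.

Lemma enorm_ge0 u : 0 <= enorm u. Proof. exact: sqrtr_ge0. Qed.

Lemma enorm_sqr u : enorm u ^+ 2 = dotp u u.
Proof. by rewrite sqr_sqrtr// dotp_ge0. Qed.

Lemma enorm_gt0 u : u != 0 -> 0 < enorm u.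
Proof.
move=> u0; rewrite lt_neqAle enorm_ge0 andbT eq_sym; apply: contra_neq u0 => e0.
by apply: dotp_eq0; rewrite -enorm_sqr e0 expr0n.
Qed.

Lemma enorm_le a u : 0 <= a -> dotp u u <= a ^+ 2 -> enorm u <= a.
Proof. by move=> a0; rewrite -enorm_sqr ler_sqr ?nnegrE ?enorm_ge0. Qed.

Lemma enorm_bearing u v : u != v -> enorm (bearing u v) = 1.
Proof.
move=> uv; have n0 : 0 < enorm (v - u) by rewrite enorm_gt0// subr_eq0 eq_sym.
apply/eqP; rewrite -(@eqrXn2 _ 2)// ?enorm_ge0// enorm_sqr dotpZl dotpZr.
by rewrite -enorm_sqr expr1n expr2 mulKf ?mulVf// gt_eqF.
Qed.

Lemma bearingC u v : bearing v u = - bearing u v.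
Proof.
rewrite /bearing -opprB scalerN; congr (- (_^-1 *: _)).
by rewrite /enorm dotpNl dotpNr opprK.
Qed.

Lemma bearing_scale a u : enorm u = 1 -> 0 < a ->
  enorm (a *: u) = a /\ (enorm (a *: u))^-1 *: (a *: u) = u.
Proof.
move=> u1 a0; have E : enorm (a *: u) = a.
  by rewrite /enorm dotpZl dotpZr -enorm_sqr u1 expr1n mulr1 -expr2 sqrtr_sqr gtr0_norm.
by rewrite E scalerA mulVf ?scale1r// gt_eqF.
Qed.

Lemma rotmx_tr a : (rotmx a)^T = rotmx (- a).
Proof.
apply/matrixP => i j; rewrite !mxE cosN sinN opprK eq_sym.
by case: i j => [[|[|//]] ?] [[|[|//]] ?].
Qed.

Lemma rotmx_trK a : (rotmx a)^T *m rotmx a = 1%:M.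
Proof.
have C := cos2Dsin2 a.
apply/matrixP => i j; rewrite !mxE big_ord_recl big_ord1 !mxE.
by case: i j => [[|[|//]] ?] [[|[|//]] ?] /=; rewrite -?C; ring.
Qed.

Lemma dotp_rot a u : dotp (rotmx a *m u) (rotmx a *m u) = dotp u u.
Proof. by rewrite /dotp trmx_mul -mulmxA (mulmxA _ (rotmx a)) rotmx_trK mul1mx. Qed.

(* From [0 <= |b u - a v|^2]. *)
Lemma dotp_le a b M u v : 0 < a -> 0 < b ->
  dotp u u <= M * a ^+ 2 -> dotp v v <= M * b ^+ 2 -> dotp u v <= M * a * b.
Proof.
move=> a0 b0 uM vM; have := dotp_ge0 (b *: u - a *: v).
rewrite !(dotpDl, dotpDr, dotpNl, dotpNr, dotpZl, dotpZr) (dotpC v u) => H.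
have Hu : b ^+ 2 * dotp u u <= b ^+ 2 * (M * a ^+ 2) by rewrite ler_pM2l ?exprn_gt0.
have Hv : a ^+ 2 * dotp v v <= a ^+ 2 * (M * b ^+ 2) by rewrite ler_pM2l ?exprn_gt0.
rewrite -(ler_pM2l (mulr_gt0 a0 b0)).
lra.
Qed.

End Plane.

(** * Lower bounds for finite sums, and a barrier function on a directed graph *)

Lemma sum_ge (R : realType) (I : finType) (P : pred I) (F : I -> R) (h : R) :
  0 <= h -> (forall i, P i -> - h <= F i) -> - (#|I|%:R * h) <= \sum_(i | P i) F i.
Proof.
move=> h0 Fh; apply: le_trans (ler_sum _ Fh); rewrite sumr_const.
by rewrite mulr_natl mulNrn lerN2 ler_wpMn2l// max_card.
Qed.

Lemma sum_ge1 (R : realType) (I : finType) (P : pred I) (F : I -> R) (h c : R) i :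
  0 <= h -> (forall i, P i -> - h <= F i) -> P i -> c <= F i ->
  c - #|I|%:R * h <= \sum_(i | P i) F i.
Proof.
move=> h0 Fh Pi ci; rewrite (bigD1 i)//= lerD//.
by apply: sum_ge => // j /andP[/Fh].
Qed.

(* [v] is [2 - e ^ d] with [d] the distance to [L] and [e = 1 / (K + 1)]: one arc
   decreases [d], and its contribution dominates those of [K] others. *)
Lemma barrier (R : realType) (I : finType) (g : rel I) (L : pred I) (K : R) :
  0 <= K -> (forall a, exists b, L b && connect g a b) ->
  exists v h : I -> R,
    [/\ forall a, 1 <= v a <= 2, forall a, 0 < h a,
        forall a b, - h a <= v a - v b
      & forall a, ~~ L a -> exists b, g a b /\ K * h a <= v a - v b].
Proof.
move=> K0 gL.
(* [reach k a] means that at most [k] arcs lead from [a] into [L]; the least such [k] is the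
   distance [d a]. *)
pose reach k := iter k (fun (S : pred I) a => S a || [exists b, g a b && S b]) L.
have ex a : exists k, reach k a.
  have [b /andP[Lb /connectP[p]]] := gL a.
  elim: p a => [|c p IH] a /=; first by move=> _ <-; exists 0%N.
  move=> /andP[ac cp] bE; have [k kc] := IH c cp bE; exists k.+1.
  by rewrite /reach /=; apply/orP; right; apply/existsP; exists c; rewrite ac.
pose d a := ex_minn (ex a); pose e : R := (K + 1)^-1.
have K1 : 0 < K + 1 by lra.
have e0 : 0 < e by rewrite invr_gt0.
have e1 : e <= 1 by rewrite invf_le1; lra.
have x0 k : 0 < e ^+ k by rewrite exprn_gt0.
have x1 k : e ^+ k <= 1 by rewrite exprn_ile1// ltW.
exists (fun a => 2 - e ^+ d a), (fun a => e ^+ d a); split=> //.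
- by move=> a; have := x0 (d a); have := x1 (d a); lra.
- by move=> a b; have := x0 (d b); lra.
move=> a La; have : (0 < d a)%N.
  by rewrite /d; case: ex_minnP => -[|//]; rewrite /reach/= (negbTE La).
have : reach (d a) a by rewrite /d; case: ex_minnP.
have da k : reach k a -> (d a <= k)%N by rewrite /d; case: ex_minnP => m _; exact.
case dE : (d a) da => [//|k] da /= /orP[/da|]; first by rewrite ltnn.
move=> /existsP[b /andP[ab kb]] _; exists b; split=> //.
have bk : (d b <= k)%N by rewrite /d; case: ex_minnP => m _; exact.
(* Here [v a - v b = e ^+ d b - e ^+ k.+1] is at least [e ^+ k - e ^+ k.+1], which is
   [K * e ^+ k.+1] because [(K + 1) * e = 1]. *)
have : e ^+ k <= e ^+ d b by apply: ler_wiXn2l => //; exact: ltW.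
have : (K + 1) * e ^+ k.+1 = e ^+ k by rewrite exprS mulrA divff ?mul1r// gt_eqF.
by rewrite -/e; lra.
Qed.

Lemma common_lower_bound (R : realType) (I : finType) (P : pred I) (F : I -> R) :
  (forall i, P i -> 0 < F i) -> exists2 c, 0 < c & forall i, P i -> c <= F i.
Proof.
move=> F0; case: (pickP P) => [i Pi|noP]; last by exists 1 => // i; rewrite noP.
have [k Pk kmin] := @Order.TotalTheory.arg_minP _ _ _ i P F Pi.
by exists (F k); [exact: F0|].
Qed.

(** * First stage: exponential convergence of the bearing estimates *)

Section FirstStage.
Variables (R : realType) (n na : nat) (N : sensor_network R n na).
Implicit Types (i j k l : 'I_n).

Lemma edge_neq i j : edge N i j -> i != j.
Proof. by apply: contraTneq => ->; rewrite edge_irr. Qed.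

Lemma pos_neq i j : edge N i j -> pos N i != pos N j.
Proof. by move=> /edge_neq; apply: contra_neq; exact: pos_inj. Qed.

Lemma bearC i j : bear N i j = - bear N j i.
Proof. exact: bearingC. Qed.

Lemma enorm_bear i j : edge N i j -> enorm (bear N i j) = 1.
Proof. by move=> /pos_neq; exact: enorm_bearing. Qed.

Lemma TA_edge i j k : TA N i j k -> edge N i j /\ edge N i k.
Proof. by case/and4P. Qed.

Lemma bear_rot i j k : TA N i j k ->
  bear N i k = rotmx (theta N i j k) *m bear N i j.
Proof.
by move=> /TA_edge[ij ik]; exact: (ccw_angleP (enorm_bear ij) (enorm_bear ik)).2.
Qed.

Lemma bear_rot_tr i j k : TA N i j k ->
  bear N i j = (rotmx (theta N i j k))^T *m bear N i k.
Proof. by move=> /bear_rot ->; rewrite mulmxA rotmx_trK mul1mx. Qed.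

(** The pairs whose error stays zero: [bear_err] vanishes by convention off the edges, and anchor
    pairs keep their true bearing. They form the target set of the barrier. *)
Definition inert i j : bool := ~~ edge N i j || anchor na i && anchor na j.

(* [coupled a b]: the estimate of the ordered pair [b] enters the evolution of that
   of [a]; an edge provides two pairs, with independent estimates. *)
Definition coupled : rel ('I_n * 'I_n) := fun a b =>
  [|| (b.1 == a.1) && (TA N a.1 b.2 a.2 || TA N a.1 a.2 b.2)
    | (b.1 == a.2) && (TA N a.2 b.2 a.1 || TA N a.2 a.1 b.2)].

(** Induction along a chain of edges ending at the anchor edge. Each step moves to the next edge,
    oriented away from the node shared with the current one; [coupled] allows this for both
    orientations of the current pair. *)
Lemma coupled_inert (hTA : TA_connected N) :
  (exists i j : 'I_n, [/\ anchor na i, anchor na j & edge N i j]) ->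
  forall a, exists b, inert b.1 b.2 && connect coupled a b.
Proof.
move=> [i0 [j0 [ai aj e0]]] [i j].
have [eij|nij] := boolP (edge N i j); last first.
  by exists (i, j); rewrite /inert /= nij connect0.
have ein k l : edge N k l -> [set k; l]%SET \in edge_set N.
  by move=> kl; rewrite inE; apply/existsP; exists k; apply/existsP; exists l; rewrite kl eqxx.
have /connectP[p] := hTA _ _ (ein _ _ eij) (ein _ _ e0).
elim: p i j eij => [|f p IH] i j eij /=.
  move=> _ /setP ij; exists (i, j); rewrite connect0 andbT /inert /= eij /=.
  have: i \in [set i0; j0]%SET by rewrite ij !inE eqxx.
  have: j \in [set i0; j0]%SET by rewrite ij !inE eqxx orbT.
  by rewrite !inE => /orP[]/eqP-> /orP[]/eqP->; rewrite ?ai ?aj.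
move=> /andP[/existsP[i' /existsP[j' /existsP[k /and4P[jk /eqP eE /eqP fE T]]]] fp] pE.
have ik : edge N i' k by case/orP: T => /TA_edge[].
have ij' : edge N i' j' by case/orP: T => /TA_edge[].
rewrite fE in fp pE; have [b /andP[b1 b2]] := IH _ _ ik fp pE.
exists b; rewrite b1 /=; apply: connect_trans b2; apply: connect1.
have ii : i \in [set i'; j']%SET by rewrite -eE !inE eqxx.
have jj : j \in [set i'; j']%SET by rewrite -eE !inE eqxx orbT.
have := edge_neq eij.
move: ii jj; rewrite !inE /coupled /= => /orP[]/eqP-> /orP[]/eqP->; rewrite ?eqxx//= => _.
  by rewrite (orbC (TA N i' k j')) T.
by rewrite (orbC (TA N i' k j')) T orbT.
Qed.

Section Flow.
Variables (e : 'I_n -> 'I_n -> 'cV[R]_2) (v : 'I_n -> 'I_n -> R).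

(** The graph Laplacian of the couplings applied to [v], arranged in the same four sums as
    [E1_rhs]. *)
Definition barrier_drop i j : R :=
  \sum_(k | TA N i k j) (v i j - v i k) + \sum_(k | TA N i j k) (v i j - v i k)
  + \sum_(k | TA N j k i) (v i j - v j k) + \sum_(k | TA N j i k) (v i j - v j k).

(** Rotations preserve norms, so by [dotp_le] each coupling to a pair [(k, l)] contributes at least
    [M * v i j * (v i j - v k l)] to the scalar product with the bracket of (E1). *)
Lemma E1_rhs_dissipation (M : R) i j : (forall k l, 0 < v k l) ->
  (forall k l, dotp (e k l) (e k l) <= M * v k l ^+ 2) ->
  dotp (e i j) (e i j) = M * v i j ^+ 2 ->
  dotp (e i j) (E1_rhs N e i j) <= - (M * v i j * barrier_drop i j).
Proof.
move=> v0 eM eij.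
have H u k l : dotp u u <= M * v k l ^+ 2 ->
    M * v i j * (v i j - v k l) <= dotp (e i j) (e i j - u).
  move=> uM; rewrite dotpDr dotpNr eij.
  have := dotp_le (v0 i j) (v0 k l) (eM i j) uM; lra.
have H' u k l : dotp u u <= M * v k l ^+ 2 ->
    M * v i j * (v i j - v k l) <= dotp (e i j) (e i j + u).
  by move=> uM; rewrite -[u]opprK; apply: H; rewrite dotpNl dotpNr opprK.
rewrite /E1_rhs /barrier_drop dotpNr lerN2 !dotpDr !dotp_sumr !mulrDr !mulr_sumr.
rewrite !lerD// ler_sum// => k _; first [apply: H | apply: H'];
  by rewrite ?rotmx_tr dotp_rot.
Qed.

End Flow.

Definition bear_err (b : 'I_n -> 'I_n -> 'cV[R]_2) k l : 'cV[R]_2 :=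
  if edge N k l then b k l - bear N k l else 0.

(** Every summand of (E1) is linear and vanishes at the true bearings, which the rotations carry
    into one another; in the sums with apex [j] the sign comes from [bearC]. *)
Lemma E1_rhs_err b i j : edge N i j -> E1_rhs N b i j = E1_rhs N (bear_err b) i j.
Proof.
move=> eij; have bC := bearC i j.
have eE k l : edge N k l -> bear_err b k l = b k l - bear N k l.
  by rewrite /bear_err => ->.
rewrite /E1_rhs (eE _ _ eij); set S1 := \sum_(k | _) _.
set S2 := \sum_(k | _) _; set S3 := \sum_(k | _) _; set S4 := \sum_(k | _) _.
suff [-> -> -> ->] : [/\
    S1 = \sum_(k | TA N i k j) (b i j - bear N i j
           - rotmx (theta N i k j) *m bear_err b i k),
    S2 = \sum_(k | TA N i j k) (b i j - bear N i j
           - (rotmx (theta N i j k))^T *m bear_err b i k),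
    S3 = \sum_(k | TA N j k i) (b i j - bear N i j
           + rotmx (theta N j k i) *m bear_err b j k)
  & S4 = \sum_(k | TA N j i k) (b i j - bear N i j
           + (rotmx (theta N j i k))^T *m bear_err b j k)] by [].
split; apply: eq_bigr => k T; have [T1 T2] := TA_edge T; rewrite eE// mulmxBr.
- by rewrite -(bear_rot T) opprB addrA subrK.
- by rewrite -(bear_rot_tr T) opprB addrA subrK.
- by rewrite -(bear_rot T) bC opprK addrACA subrr addr0.
- by rewrite -(bear_rot_tr T) bC opprK addrACA subrr addr0.
Qed.

Lemma barrier_drop_gt (hTA : TA_connected N) :
  (exists i j : 'I_n, [/\ anchor na i, anchor na j & edge N i j]) ->
  exists (v : 'I_n -> 'I_n -> R) (lam : R),
    [/\ 0 < lam, forall i j, 1 <= v i j <= 2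
      & forall i j, ~~ inert i j -> lam * v i j < barrier_drop v i j].
Proof.
(* The four sums have at most [n] terms each, all at least [- H]; one term of size [K * H] leaves a
   total of at least [H]. *)
move=> anc; pose K : R := (4 * n + 1)%:R.
have K0 : 0 <= K by rewrite ler0n.
have [v [h [v12 h0 vh vK]]] := barrier K0 (coupled_inert hTA anc).
have [c c0 hc] := common_lower_bound (P := xpredT) (fun a _ => h0 a).
(* As [v <= 2], the rate [c / 3] gives [lam * v <= 2 * c / 3 < c <= H]. *)
exists (fun i j => v (i, j)), (c / 3); split=> [||i j nij].
- by rewrite divr_gt0.
- by move=> i j; exact: v12.
have [[k l] [ab Kh]] := vK (i, j) nij; rewrite /= in ab Kh.
have := v12 (i, j); have := hc (i, j) isT; set H := h (i, j) => hcH vij.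
apply: (@lt_le_trans _ _ H); first by nra.
pose X := (n%:R : R) * H.
have KX : K * H = 4 * X + H by rewrite /K natrD natrM /X; ring.
have hij : 0 <= H by apply/ltW/h0.
have lo (P : pred 'I_n) (f : 'I_n -> 'I_n * 'I_n) :
    - X <= \sum_(k | P k) (v (i, j) - v (f k)).
  have := @sum_ge R 'I_n P (fun k => v (i, j) - v (f k)) H; rewrite card_ord; apply=> // q _.
  exact: vh.
have hi (P : pred 'I_n) (f : 'I_n -> 'I_n * 'I_n) : P l -> f l = (k, l) ->
    K * H - X <= \sum_(k | P k) (v (i, j) - v (f k)).
  move=> Pl fl; have := @sum_ge1 R 'I_n P (fun k => v (i, j) - v (f k)) H (K * H) l.
  by rewrite card_ord; apply => // [q _|]; [exact: vh|rewrite fl].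
rewrite /barrier_drop.
have l1 := lo (fun k => TA N i k j) (pair i).
have l2 := lo (fun k => TA N i j k) (pair i).
have l3 := lo (fun k => TA N j k i) (pair j).
have l4 := lo (fun k => TA N j i k) (pair j).
case/orP: ab => /andP[/eqP/= kE /orP[T|T]]; rewrite kE /= in hi.
- by have := hi (fun k => TA N i k j) (pair i) T erefl; lra.
- by have := hi (fun k => TA N i j k) (pair i) T erefl; lra.
- by have := hi (fun k => TA N j k i) (pair j) T erefl; lra.
- by have := hi (fun k => TA N j i k) (pair j) T erefl; lra.
Qed.

Lemma bear_err_evolves b : E1_trajectory N b -> forall i j,
  evolves (fun t => bear_err (fun k l => b k l t) i j)
    (fun t => if inert i j then 0
              else E1_rhs N (bear_err (fun k l => b k l t)) i j).
Proof.
move=> traj i j; have [eij|nij] := boolP (edge N i j); last first.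
  apply: evolves_eq (evolves_cst 0) => t _; first by rewrite /bear_err (negbTE nij).
  by rewrite /inert nij.
have := traj i j eij; rewrite /inert eij /=; case: ifP => [_ bE|_ ev].
  by apply: evolves_eq (evolves_cst 0) => // t t0; rewrite /bear_err eij bE// subrr.
apply: evolves_eq (evolvesB ev (evolves_cst (bear N i j))) => t _.
  by rewrite /bear_err eij.
by rewrite subr0 (E1_rhs_err _ eij).
Qed.

Lemma evolves_dotp (f g : R -> 'cV[R]_2) : evolves f g ->
  evolves (fun t => dotp (f t) (f t)) (fun t => 2 * dotp (f t) (g t)).
Proof.
move=> fg; have e0 := evolves_coord 0 0 fg; have e1 := evolves_coord 1 0 fg.
apply: evolves_eq (evolvesD (evolvesM e0 e0) (evolvesM e1 e1)) => t _.
  by rewrite dotpE.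
by rewrite dotpE; ring.
Qed.

Lemma E1_decay (hTA : TA_connected N) :
  (exists i j : 'I_n, [/\ anchor na i, anchor na j & edge N i j]) ->
  exists2 lam : R, 0 < lam & forall b, E1_trajectory N b ->
    forall i j, edge N i j -> forall t : R, 0 <= t ->
    enorm (b i j t - bear N i j)
      <= 2 * expR (- lam * t) * E1_error N (fun k l => b k l 0).
Proof.
move=> anc; have [v [lam [lam0 v12 vd]]] := barrier_drop_gt hTA anc.
exists lam => // b traj i j eij t t0.
have v0 k l : 0 < v k l by have := v12 k l; lra.
set E := E1_error _ _.
have E0 : 0 <= E by apply: sumr_ge0 => k _; apply: sumr_ge0 => l _; exact: enorm_ge0.
pose er k l s := bear_err (fun k l => b k l s) k l.
(* The maximum principle is applied to [|e a| ^ 2 / v a ^ 2 * exp (2 lam t)]; squaring avoids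
   differentiating the norm at zero. *)
have ev (a : 'I_n * 'I_n) := evolvesM
  (evolvesM (evolves_dotp (bear_err_evolves traj a.1 a.2))
            (evolves_cst ((v a.1 a.2) ^- 2)))
  (evolves_expR (2 * lam)).
have x0 s : 0 < expR (2 * lam * s) by exact: expR_gt0.
have X0 : 0 <= E ^+ 2 by exact: sqr_ge0.
have := maximum_principle X0 ev _ _ (i, j) t0; rewrite /= -/(er _ _ _).
have vv k l : 0 < v k l ^+ 2 by rewrite exprn_gt0.
move=> H.
have {}H : dotp (er i j t) (er i j t) / v i j ^+ 2 * expR (2 * lam * t) <= E ^+ 2.
  apply: H => [[k l]|[k l] s s0] /=.
    rewrite mulr0 expR0 mulr1 ler_pdivrMr// -/(er k l 0).
    have er_le : dotp (er k l 0) (er k l 0) <= E ^+ 2.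
      rewrite /er /bear_err; case: ifPn => [ekl|_]; last by rewrite dotp0l.
      rewrite -enorm_sqr ler_sqr ?nnegrE ?enorm_ge0// /E /E1_error.
      rewrite (bigD1 k)//= (bigD1 l)//= -addrA lerDl addr_ge0 ?sumr_ge0//.
        by move=> ? _; exact: enorm_ge0.
      by move=> ? _; apply: sumr_ge0 => ? _; exact: enorm_ge0.
    apply: le_trans er_le _; rewrite ler_peMr ?dotp_ge0 ?sqr_ge0//.
    by apply: exprn_ege1; case/andP: (v12 k l).
  rewrite -!/(er _ _ s) => qpos qmax.
  set q := dotp (er k l s) (er k l s) in qpos *.
  have q0 : 0 < q.
    move: qpos; rewrite pmulr_lgt0// pmulr_lgt0// invr_gt0; exact: vv.
  pose M := q / v k l ^+ 2.
  have M0 : 0 < M by rewrite divr_gt0.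
  have nin : ~~ inert k l.
    apply: contraTN q0 => /orP[nkl|/andP[ak al]].
      by rewrite /q /er /bear_err (negbTE nkl) dotp0l ltxx.
    rewrite /q /er /bear_err; case: ifPn => [ekl|_]; last by rewrite dotp0l ltxx.
    have := traj k l ekl; rewrite ak al /= => bE.
    by rewrite bE ?subrr ?dotp0l ?ltxx// ltW.
  have diss : dotp (er k l s) (E1_rhs N (fun k l => er k l s) k l)
      <= - (M * v k l * barrier_drop v k l).
    apply: E1_rhs_dissipation => //.
      move=> k' l'; have := qmax (k', l'); rewrite /= -!/(er _ _ s) -/q.
      by rewrite ler_pM2r// -/M ler_pdivrMr.
    by rewrite /M divfK// gt_eqF.
  rewrite (negbTE nin) -/q.
  have qM : q = M * v k l ^+ 2 by rewrite /M divfK// gt_eqF.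
  (* The derivative is a positive multiple of a sum whose first term is [M * v * (lam * v)] and
     whose second is at most [- M * v * barrier_drop]; the barrier inequality makes it negative. *)
  have -> : q / v k l ^+ 2 * (2 * lam * expR (2 * lam * s))
      + expR (2 * lam * s) * (q * 0 + v k l ^- 2 *
          (2 * dotp (er k l s) (E1_rhs N (fun k l => er k l s) k l)))
    = (2 * expR (2 * lam * s) / v k l ^+ 2) *
      (lam * q + dotp (er k l s) (E1_rhs N (fun k l => er k l s) k l)) by ring.
  rewrite pmulr_rlt0; last by rewrite divr_gt0// mulr_gt0.
  have : M * v k l * (lam * v k l) < M * v k l * barrier_drop v k l.
    have Mv : 0 < M * v k l by exact: mulr_gt0.
    by rewrite (ltr_pM2l Mv); exact: vd.
  by rewrite qM; nra.
have erE : er i j t = b i j t - bear N i j by rewrite /er /bear_err eij.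
rewrite -erE; apply: enorm_le.
  by rewrite !mulr_ge0// ltW// expR_gt0.
move: H; rewrite -ler_pdivlMr// ler_pdivrMr// => H; apply: le_trans H _.
have -> : 2 * lam * t = lam * t + lam * t by ring.
rewrite expRD mulNr expRN.
set x := expR (lam * t).
have xp : 0 < x by exact: expR_gt0.
(* The factor 2 is the upper bound of [v]; the lower bound 1 served for the initial values. *)
have -> : (2 * x^-1 * E) ^+ 2 = E ^+ 2 / (x * x) * 2 ^+ 2.
  by rewrite invfM; ring.
apply: ler_wpM2l; first by rewrite divr_ge0// mulr_ge0// ltW.
by rewrite ler_sqr ?nnegrE//; [case/andP: (v12 i j)|exact: ltW].
Qed.

End FirstStage.

(** * Coercivity of injective linear maps between finite families of reals *)

Lemma injective_coercive (R : realType) (I J : finType) (F : (I -> R) -> J -> R) :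
  (forall s y z j, F (fun i => s * y i + z i) j = s * F y j + F z j) ->
  (forall y, (forall j, F y j = 0) -> forall i, y i = 0) ->
  exists2 C : R, 0 < C &
    forall y, \sum_i y i ^+ 2 <= C * \sum_j F y j ^+ 2.
Proof.
move=> lin inj; pose e i : I -> R := fun k => (k == i)%:R.
have FE y j : F y j = \sum_i y i * F (e i) j.
  have H (s : seq I) :
      F (fun k => \sum_(i <- s) y i * e i k) j = \sum_(i <- s) y i * F (e i) j.
    elim: s => [|i s IH].
      have -> : (fun k => \sum_(i <- [::]) y i * e i k) = fun=> 0.
        by apply/funext => k; rewrite big_nil.
      have := lin 1 (fun=> 0) (fun=> 0) j.
      have -> : (fun _ : I => 1 * 0 + 0 : R) = fun=> 0 by apply/funext => k; ring.
      by rewrite big_nil; lra.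
    rewrite big_cons -IH -lin; congr (F _ j).
    by apply/funext => k; rewrite big_cons.
  rewrite -H; congr (F _ j); apply/funext => k.
  rewrite (bigD1 k)//= /e eqxx mulr1 big1 ?addr0// => i ik.
  by rewrite eq_sym (negbTE ik) mulr0.
(* Injectivity of [F] makes its matrix, acting on row vectors, row free; a right inverse [B] then
   recovers each [y i] linearly from the values [F y j]. *)
pose A := \matrix_(a < #|I|, b < #|J|) F (e (enum_val a)) (enum_val b).
have AE (v : 'rV[R]_#|I|) j :
    (v *m A) 0 (enum_rank j) = F (fun i => v 0 (enum_rank i)) j.
  rewrite mxE FE (reindex (@enum_rank I))/=; last first.
    by apply: onW_bij; exact: enum_rank_bij.
  by apply: eq_bigr => i _; rewrite mxE !enum_rankK.
have /row_freeP[B AB] : row_free A.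
  apply: inj_row_free => v vA; apply/rowP => a; rewrite mxE.
  rewrite -(enum_valK a); apply: (inj (fun i => v 0 (enum_rank i))) => j.
  by rewrite -AE vA mxE.
have yE y i : y i = \sum_j F y j * B (enum_rank j) (enum_rank i).
  pose v : 'rV[R]_#|I| := \row_a y (enum_val a).
  have vy : (fun i => v 0 (enum_rank i)) = y.
    by apply/funext => k; rewrite mxE enum_rankK.
  transitivity (v 0 (enum_rank i)); first by rewrite mxE enum_rankK.
  rewrite -[v]mulmx1 -AB mulmxA mxE (reindex (@enum_rank J))/=; last first.
    by apply: onW_bij; exact: enum_rank_bij.
  by apply: eq_bigr => j _; rewrite AE vy.
pose beta i := \sum_j `|B (enum_rank j) (enum_rank i)|.
(* Each [|y i|] is at most [beta i] times the root of the sum of the squares [F y j ^+ 2]; the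
   summand 1 makes the constant positive. *)
exists (1 + \sum_i beta i ^+ 2).
  by rewrite ltr_pwDl// sumr_ge0// => i _; exact: sqr_ge0.
move=> y; set S := \sum_j F y j ^+ 2.
have S0 : 0 <= S by apply: sumr_ge0 => j _; exact: sqr_ge0.
have FS j : `|F y j| <= Num.sqrt S.
  rewrite -sqrtr_sqr; apply: ler_wsqrtr; rewrite /S (bigD1 j)//= lerDl.
  by apply: sumr_ge0 => ? _; exact: sqr_ge0.
apply: (@le_trans _ _ (\sum_i beta i ^+ 2 * S)); last first.
  by rewrite -mulr_suml ler_wpM2r// lerDr.
apply: ler_sum => i _; rewrite -[X in _ * X](sqr_sqrtr S0) -exprMn.
rewrite -[leLHS]real_normK ?num_real// ler_sqr ?nnegrE ?mulr_ge0 ?sqrtr_ge0 ?sumr_ge0//.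
rewrite {1}yE (le_trans (ler_norm_sum _ _ _))// mulr_suml ler_sum// => j _.
by rewrite normrM mulrC ler_wpM2l.
Qed.

Lemma sum_pair (V : nmodType) (I J : finType) (F : I * J -> V) :
  \sum_p F p = \sum_i \sum_j F (i, j).
Proof. by rewrite pair_bigA; apply: eq_bigr => -[]. Qed.

(** * Residuals of the second stage: rigidity, coercivity, dissipation *)

Section Residuals.
Variables (R : realType) (n na : nat) (N : sensor_network R n na).
Implicit Types (i j k l : 'I_n).

Lemma dist_gt0 i j : edge N i j -> 0 < dist N i j.
Proof. by move=> /pos_neq ij; rewrite enorm_gt0// subr_eq0 eq_sym. Qed.

Lemma pos_edge i j : edge N i j -> pos N j - pos N i = dist N i j *: bear N i j.
Proof.
by move=> /dist_gt0 d0; rewrite /bear /bearing scalerA mulfV ?scale1r// gt_eqF.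
Qed.

Lemma TD_edge i j k : TD N i j k -> edge N i j /\ edge N i k.
Proof. by case/and4P. Qed.

(** A positive multiple of a unit vector determines both factors, so [x] has the true bearings and
    the edge lengths [D]. This serves for the true positions as well as for their shifts. *)
Lemma same_bearings_solution (x : 'I_n -> 'cV[R]_2) (D : 'I_n -> 'I_n -> R) :
  (forall i j, edge N i j -> 0 < D i j /\ x j - x i = D i j *: bear N i j) ->
  (forall i j k, TD N i j k -> D i k = kappa N i j k * D i j) ->
  (forall i, anchor na i -> x i = pos N i) ->
  SA_RoD_solution N x.
Proof.
move=> xD DK xa.
have H i j : edge N i j -> enorm (x j - x i) = D i j /\ bearing (x i) (x j) = bear N i j.
  move=> ij; have [D0 E] := xD _ _ ij; rewrite /bearing E.
  exact: bearing_scale (enorm_bear ij) D0.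
split=> // [i j ij xij|i j k T|i j k T].
- have [E _] := H _ _ ij; have [+ _] := xD _ _ ij.
  by rewrite -E xij subrr /enorm dotp0l sqrtr0 ltxx.
- have [ij ik] := TA_edge T; have [_ ->] := H _ _ ij; have [_ ->] := H _ _ ik.
  exact: bear_rot.
- have [ij ik] := TD_edge T; have [-> _] := H _ _ ij; have [-> _] := H _ _ ik.
  by rewrite (DK _ _ _ T) mulfK// gt_eqF//; case: (xD _ _ ij).
Qed.

Definition res_x (x : 'I_n -> 'cV[R]_2) (d : 'I_n -> 'I_n -> R) i j :=
  x j - x i - d i j *: bear N i j.

Definition res_d (d : 'I_n -> 'I_n -> R) i j k := d i k - kappa N i j k * d i j.

(* A null direction of the residuals would, in a small multiple, be a second
   solution of the localization problem. *)
Lemma localizable_rigid (hloc : SA_RoD_localizable N) x d :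
  (forall i j, edge N i j -> res_x x d i j = 0) ->
  (forall i j k, TD N i j k -> res_d d i j k = 0) ->
  (forall i, anchor na i -> x i = 0) ->
  (forall i, x i = 0) /\ (forall i j, edge N i j -> d i j = 0).
Proof.
move=> rx rd xa.
have xd i j : edge N i j -> x j - x i = d i j *: bear N i j.
  by move=> /rx/eqP; rewrite subr_eq0 => /eqP.
(* With [s * (|d i j| + 1) <= dist i j] on every edge, the shifted lengths [dist i j + s * d i j]
   remain strictly positive. *)
have [s s0 sP] : exists2 s : R, 0 < s & forall a : 'I_n * 'I_n, edge N a.1 a.2 ->
    s <= dist N a.1 a.2 / (`|d a.1 a.2| + 1).
  by apply: common_lower_bound => a /dist_gt0 ?; rewrite divr_gt0// ltr_wpDl.
have p_sol : SA_RoD_solution N (pos N).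
  apply: (@same_bearings_solution _ (dist N)) => // [i j ij|i j k /TD_edge[ij _]].
    by rewrite pos_edge// dist_gt0.
  by rewrite /kappa divfK// gt_eqF// dist_gt0.
have x_sol : SA_RoD_solution N (fun i => pos N i + s *: x i).
  apply: (@same_bearings_solution _ (fun i j => dist N i j + s * d i j)).
  - move=> i j ij; split.
      have d1 : 0 < `|d i j| + 1 by rewrite ltr_wpDl.
      have := sP (i, j) ij; rewrite /= (ler_pdivlMr _ _ d1) => H.
      have : - (s * `|d i j|) <= s * d i j by rewrite -mulrN ler_pM2l// lerNl ler_normr lexx orbT.
      lra.
    by rewrite opprD addrACA (pos_edge ij) -scalerBr (xd _ _ ij) scalerDl -(scalerA s).
  - move=> i j k T; have [ij ik] := TD_edge T.
    have := rd _ _ _ T; rewrite /res_d => /eqP; rewrite subr_eq0 => /eqP ->.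
    by rewrite mulrDr /kappa divfK ?gt_eqF ?dist_gt0//; ring.
  - by move=> i ai; rewrite xa// scaler0 addr0.
have x0 i : x i = 0.
  case: hloc => y [_ uniq].
  have := uniq _ x_sol; rewrite (uniq _ p_sol) => /(congr1 (fun f => f i)) /eqP.
  rewrite eq_sym -subr_eq0 addrAC subrr add0r scaler_eq0 gt_eqF//=.
  by move/eqP.
split=> // i j ij; have := xd _ _ ij; rewrite !x0 subrr => /esym/eqP.
rewrite scaler_eq0 => /orP[/eqP//|/eqP b0].
by have := enorm_bear ij; rewrite b0 /enorm dotp0l sqrtr0 => /eqP; rewrite eq_sym oner_eq0.
Qed.

Lemma dotp_sqr (u : 'cV[R]_2) : dotp u u = \sum_c u c 0 ^+ 2.
Proof.
rewrite dotpE big_ord_recl big_ord1 !expr2.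
by congr (_ + u _ _ * u _ _); apply/val_inj.
Qed.

(** Comparable to [V] without being a multiple of it: for symmetric [d] each edge residual counts
    twice, once per orientation, and each ratio residual once. *)
Definition E2_residual x d :=
  \sum_i \sum_(j | edge N i j) dotp (res_x x d i j) (res_x x d i j)
  + \sum_i \sum_j \sum_(k | TD N i j k) res_d d i j k ^+ 2.

(** The anchor coordinates of [x] and the entries of [d] off the edges are added to the residuals:
    the resulting linear map [F] is injective by [localizable_rigid], and under the two constraints
    the added components vanish. *)
Lemma E2_coercive (hloc : SA_RoD_localizable N) :
  exists2 C : R, 0 < C & forall x d,
    (forall i, anchor na i -> x i = 0) ->
    (forall i j, ~~ edge N i j -> d i j = 0) ->
    \sum_i dotp (x i) (x i) + \sum_i \sum_j d i j ^+ 2 <= C * E2_residual x d.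
Proof.
pose I : finType := (('I_n * 'I_2) + ('I_n * 'I_n))%type.
pose J : finType := (('I_n * 'I_n * 'I_2) + ('I_n * 'I_n * 'I_n)
                     + (('I_n * 'I_2) + ('I_n * 'I_n)))%type.
pose X (y : I -> R) i : 'cV[R]_2 := \col_c y (inl (i, c)).
pose D (y : I -> R) i j := y (inr (i, j)).
pose F (y : I -> R) (a : J) : R := match a with
  | inl (inl (i, j, c)) => if edge N i j then res_x (X y) (D y) i j c 0 else 0
  | inl (inr (i, j, k)) => if TD N i j k then res_d (D y) i j k else 0
  | inr (inl (i, c)) => if anchor na i then X y i c 0 else 0
  | inr (inr (i, j)) => if edge N i j then 0 else D y i j
  end.
have [||C C0 HC] := @injective_coercive R I J F.
- move=> s y z [[[[i j] c]|[[i j] k]]|[[i c]|[i j]]] /=; case: ifP => _;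
    rewrite /res_x /res_d ?mxE /D; ring.
- move=> y F0.
  have [X0 D0] : (forall i, X y i = 0) /\ (forall i j, edge N i j -> D y i j = 0).
    apply: localizable_rigid => // [i j ij|i j k T|i ai].
    + by apply/colP => c; have := F0 (inl (inl (i, j, c))); rewrite /= ij => ->; rewrite mxE.
    + by have := F0 (inl (inr (i, j, k))); rewrite /= T.
    + by apply/colP => c; have := F0 (inr (inl (i, c))); rewrite /= ai => ->; rewrite mxE.
  move=> [[i c]|[i j]].
    by have /colP/(_ c) := X0 i; rewrite !mxE.
  have [ij|nij] := boolP (edge N i j); first exact: D0.
  by have := F0 (inr (inr (i, j))); rewrite /= (negbTE nij).
exists C => // x d xa dn.
pose y (a : I) := match a with inl (i, c) => x i c 0 | inr (i, j) => d i j end.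
have XE : X y = x.
  by apply/funext => i; apply/colP => c; rewrite mxE.
have DE : D y = d by apply/funext => i; apply/funext => j.
have := HC y; rewrite !big_sumType !sum_pair /=.
have -> : \sum_i \sum_c x i c 0 ^+ 2 = \sum_i dotp (x i) (x i).
  by apply: eq_bigr => i _; rewrite dotp_sqr.
move=> H; apply: le_trans H _; rewrite ler_pM2l// XE DE /E2_residual.
have -> : \sum_i \sum_(c < 2) (if anchor na i then x i c 0 else 0) ^+ 2 = 0.
  apply: big1 => i _; apply: big1 => c _.
  by case: ifP => [/xa->|_]; rewrite ?mxE expr0n.
have -> : \sum_i \sum_j (if edge N i j then 0 else d i j) ^+ 2 = 0.
  apply: big1 => i _; apply: big1 => j _.
  by case: ifPn => [_|/dn->]; rewrite expr0n.
rewrite !addr0; apply: lerD; apply: ler_sum => i _.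
  rewrite [leRHS]big_mkcond; apply: ler_sum => j _; case: ifP => ij; last first.
    by rewrite big1// => c _; rewrite expr0n.
  by rewrite dotp_sqr.
apply: ler_sum => j _; rewrite [leRHS]big_mkcond; apply: ler_sum => k _.
by case: ifP => // _; rewrite expr0n.
Qed.

Lemma sum_edge_swap (F : 'I_n -> 'I_n -> R) :
  \sum_i \sum_(j | edge N i j) F i j = \sum_i \sum_(j | edge N i j) F j i.
Proof.
under eq_bigr do rewrite big_mkcond; rewrite exchange_big /=.
by apply: eq_bigr => i _; rewrite [RHS]big_mkcond; apply: eq_bigr => j _; rewrite edge_sym.
Qed.

Lemma E2_rhs_xE x d i : E2_rhs_x N x d i = \sum_(j | edge N i j) res_x x d i j.
Proof.
rewrite /E2_rhs_x -sumrN; apply: eq_bigr => j _.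
by rewrite /res_x opprD opprB.
Qed.

(** Minus the partial derivative in [d i j] of half the sum of the squared ratio residuals, with
    [d i j] and [d j i] taken as independent variables. *)
Definition ratio_force d i j : R :=
  \sum_(k | TD N i j k) kappa N i j k * res_d d i j k
  - \sum_(k | TD N i k j) res_d d i k j.

Lemma E2_rhs_dE x d i j : edge N i j -> d i j = d j i ->
  E2_rhs_d N x d i j =
  dotp (bear N i j) (res_x x d i j) + ratio_force d i j + ratio_force d j i.
Proof.
move=> ij dC; rewrite /E2_rhs_d /res_x /ratio_force /res_d !dotpDr !dotpNr dotpZr.
by rewrite -enorm_sqr (enorm_bear ij) expr1n mulr1 -dC; ring.
Qed.

(** Summation by parts: at each ordered edge the terms from [x] and from [d] add up to minus the
    squared residual. The ratio residuals come out twice, from the two ends of an edge; dropping one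
    copy gives the inequality. *)
Lemma E2_dissipation x d :
  (forall i j, d i j = d j i) -> (forall i j, ~~ edge N i j -> d i j = 0) ->
  2 * \sum_i dotp (x i) (E2_rhs_x N x d i)
  + \sum_i \sum_(j | edge N i j) d i j * E2_rhs_d N x d i j
  <= - E2_residual x d.
Proof.
move=> dC dn; set r := res_x x d.
have rC i j : r j i = - r i j.
  by rewrite /r /res_x opprD opprB opprK (bearC N j i) scalerN opprK dC.
have Ex : 2 * \sum_i dotp (x i) (E2_rhs_x N x d i)
    = \sum_i \sum_(j | edge N i j) - dotp (x j - x i) (r i j).
  rewrite (_ : \sum_i _ = \sum_i \sum_(j | edge N i j) dotp (x i) (r i j)).
    rewrite mulr2n mulrDl mul1r {2}sum_edge_swap -big_split; apply: eq_bigr => i _.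
    rewrite -big_split; apply: eq_bigr => j _.
    by rewrite /= (rC i j) dotpNr dotpDl dotpNl; ring.
  by apply: eq_bigr => i _; rewrite E2_rhs_xE dotp_sumr.
(* Euler's identity for a quadratic form: once the sums in the second half of [ratio_force] are
   exchanged, each triple collects [kappa * d i j - d i k], that is [- res_d], as the coefficient of
   [res_d]. *)
have Er : \sum_i \sum_(j | edge N i j) d i j * ratio_force d i j
    = - \sum_i \sum_j \sum_(k | TD N i j k) res_d d i j k ^+ 2.
  rewrite -sumrN; apply: eq_bigr => i _.
  transitivity (\sum_j d i j * ratio_force d i j).
    rewrite big_mkcond; apply: eq_bigr => j _; case: ifPn => // /dn ->.
    by rewrite mul0r.
  under eq_bigr do rewrite mulrBr !mulr_sumr.
  rewrite sumrB [X in _ - X](exchange_big_dep xpredT)//= -sumrB -sumrN.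
  apply: eq_bigr => j _; rewrite -sumrB -sumrN; apply: eq_bigr => k _.
  by rewrite /res_d; ring.
have Ed : \sum_i \sum_(j | edge N i j) d i j * E2_rhs_d N x d i j
    = \sum_i \sum_(j | edge N i j) d i j * dotp (bear N i j) (r i j)
      + 2 * \sum_i \sum_(j | edge N i j) d i j * ratio_force d i j.
  rewrite mulr2n mulrDl mul1r.
  rewrite {2}(sum_edge_swap (fun i j => d i j * ratio_force d i j)) -!big_split.
  apply: eq_bigr => i _.
  rewrite -!big_split; apply: eq_bigr => j ij /=.
  by rewrite (E2_rhs_dE _ ij (dC i j)) (dC j i); ring.
have S0 : 0 <= \sum_i \sum_j \sum_(k | TD N i j k) res_d d i j k ^+ 2.
  by do 3!apply: sumr_ge0 => ? _; exact: sqr_ge0.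
have Err : \sum_i \sum_(j | edge N i j) - dotp (x j - x i) (r i j)
    + \sum_i \sum_(j | edge N i j) d i j * dotp (bear N i j) (r i j)
    = - \sum_i \sum_(j | edge N i j) dotp (r i j) (r i j).
  rewrite -big_split -sumrN; apply: eq_bigr => i _.
  rewrite -big_split -sumrN; apply: eq_bigr => j ij /=.
  have -> : dotp (r i j) (r i j)
      = dotp (x j - x i) (r i j) - d i j * dotp (bear N i j) (r i j).
    by rewrite -dotpZl -(dotpNl (d i j *: _)) -(dotpDl (x j - x i)).
  by rewrite opprB addrC.
by rewrite Ed Ex Er addrA Err /E2_residual; lra.
Qed.
End Residuals.

Lemma sqr_sum_ge (R : realType) (I : finType) (P : pred I) (F : I -> R) :
  (forall i, P i -> 0 <= F i) ->
  \sum_(i | P i) F i ^+ 2 <= (\sum_(i | P i) F i) ^+ 2.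
Proof.
move=> F0; rewrite [leRHS]expr2 mulr_suml; apply: ler_sum => i Pi.
rewrite expr2 ler_wpM2l ?F0// (bigD1 i)//= lerDl sumr_ge0// => j /andP[Pj _].
exact: F0.
Qed.

(** * Second stage: exponential convergence of positions and distances *)

Section SecondStage.
Variables (R : realType) (n na : nat) (N : sensor_network R n na).
Implicit Types (i j k l : 'I_n) (x : 'I_n -> 'cV[R]_2) (d : 'I_n -> 'I_n -> R).

Lemma distC i j : dist N i j = dist N j i.
Proof. by rewrite /dist -opprB /enorm dotpNl dotpNr opprK. Qed.

Definition pos_err x i := x i - pos N i.

Definition dist_err d i j : R := if edge N i j then d i j - dist N i j else 0.

(** The residual is linear and zero at the true configuration; with [res_d_err] this carries the
    flow over to error coordinates. *)
Lemma res_x_err x d i j : edge N i j ->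
  res_x N x d i j = res_x N (pos_err x) (dist_err d) i j.
Proof.
move=> ij; rewrite /res_x /pos_err /dist_err ij scalerBl -(pos_edge ij).
by apply/matrixP => a b; rewrite !mxE; ring.
Qed.

Lemma res_d_err d i j k : TD N i j k ->
  res_d N d i j k = res_d N (dist_err d) i j k.
Proof.
move=> /TD_edge[ij ik]; rewrite /res_d /dist_err ij ik mulrBr /kappa.
by rewrite [X in _ - (_ - X)]divfK ?gt_eqF ?dist_gt0//; ring.
Qed.

Lemma E2_rhs_x_err x d i :
  E2_rhs_x N x d i = E2_rhs_x N (pos_err x) (dist_err d) i.
Proof. by rewrite !E2_rhs_xE; apply: eq_bigr => j; exact: res_x_err. Qed.

Lemma E2_rhs_d_err x d i j : edge N i j -> d i j = d j i ->
  E2_rhs_d N x d i j = E2_rhs_d N (pos_err x) (dist_err d) i j.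
Proof.
move=> ij dC; have ji : edge N j i by rewrite edge_sym.
have H k l : ratio_force N d k l = ratio_force N (dist_err d) k l.
  by rewrite /ratio_force; congr (_ - _); apply: eq_bigr => m T; rewrite (res_d_err _ T).
have edC : dist_err d i j = dist_err d j i.
  by rewrite /dist_err ij ji dC (distC i j).
by rewrite (E2_rhs_dE _ ij dC) (E2_rhs_dE _ ij edC) (res_x_err _ _ ij) !H.
Qed.

Lemma E2_error_sqr_ge x d :
  \sum_i dotp (pos_err x i) (pos_err x i) + \sum_i \sum_j dist_err d i j ^+ 2
  <= E2_error N x d ^+ 2.
Proof.
have A0 : 0 <= \sum_i enorm (pos_err x i).
  by apply: sumr_ge0 => i _; exact: enorm_ge0.
have B0 : 0 <= \sum_i \sum_(j | edge N i j) `|d i j - dist N i j|.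
  by do 2!apply: sumr_ge0 => ? _; exact: normr_ge0.
apply: (@le_trans _ _ ((\sum_i enorm (pos_err x i)) ^+ 2
    + (\sum_i \sum_(j | edge N i j) `|d i j - dist N i j|) ^+ 2)); last first.
  by rewrite /E2_error sqrrD lerD2r lerDl mulrn_wge0// mulr_ge0.
apply: lerD.
  under eq_bigr do rewrite -enorm_sqr.
  by apply: sqr_sum_ge => i _; exact: enorm_ge0.
apply: le_trans (sqr_sum_ge _); last first.
  by move=> i _; apply: sumr_ge0 => ? _; exact: normr_ge0.
apply: ler_sum => i _; apply: le_trans (sqr_sum_ge _); last first.
  by move=> j _; exact: normr_ge0.
rewrite [leRHS]big_mkcond; apply: ler_sum => j _; rewrite /dist_err.
by case: ifP => _; rewrite ?expr0n// real_normK ?num_real.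
Qed.

(** The squared norm of the error with one distance variable per undirected edge: the factor [2^-1]
    undoes the double count of ordered pairs. *)
Definition E2_energy x d : R :=
  \sum_i dotp (pos_err x i) (pos_err x i)
  + 2^-1 * \sum_i \sum_(j | edge N i j) dist_err d i j ^+ 2.

Lemma E2_energy_evolves (x' : 'I_n -> R -> 'cV[R]_2) (d' : 'I_n -> 'I_n -> R -> R) :
  E2_trajectory N x' d' ->
  exists2 g : R -> R,
    evolves (fun t => E2_energy (fun k => x' k t) (fun k l => d' k l t)) g
    & forall t, 0 < t -> g t <= - E2_residual N
        (pos_err (fun k => x' k t)) (dist_err (fun k l => d' k l t)).
Proof.
move=> [dC tx td].
pose ex t := pos_err (fun k => x' k t); pose ed t := dist_err (fun k l => d' k l t).
pose vx t i := if anchor na i then 0 else E2_rhs_x N (ex t) (ed t) i.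
pose vd t i j := if anchor na i && anchor na j then 0 else E2_rhs_d N (ex t) (ed t) i j.
have evx i : evolves (fun t => ex t i) (vx ^~ i).
  rewrite /vx; have := tx i; case: ifP => [_ xE|_ ev].
    by apply: evolves_eq (evolves_cst 0) => // t t0; rewrite /ex /pos_err xE// subrr.
  apply: evolves_eq (evolvesB ev (evolves_cst (pos N i))) => // t t0.
  by rewrite subr0 E2_rhs_x_err.
have evd i j : edge N i j -> evolves (fun t => ed t i j) (fun t => vd t i j).
  move=> ij; rewrite /vd; have := td i j ij; case: ifP => [_ dE|_ ev].
    apply: evolves_eq (evolves_cst 0) => // t t0.
    by rewrite /ed /dist_err ij dE// subrr.
  apply: evolves_eq (evolvesB ev (evolves_cst (dist N i j))) => t t0.
    by rewrite /ed /dist_err ij.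
  by rewrite subr0 (E2_rhs_d_err _ ij)// dC// ltW.
have ev1 := @evolves_sum _ 'I_n xpredT _ _ (fun i _ => evolves_dotp (evx i)).
have ev2 := @evolves_sum _ 'I_n xpredT _ _ (fun i _ =>
  @evolves_sum _ 'I_n (edge N i) _ _ (fun j ij => evolvesM (evd i j ij) (evd i j ij))).
have ev := evolvesD ev1 (evolvesM (evolves_cst (2^-1 : R)) ev2).
eexists; first exact: ev.
move=> t t0 /=; rewrite -/(ex t) -/(ed t).
have edC i j : ed t i j = ed t j i.
  rewrite /ed /dist_err edge_sym; case: ifP => // ji.
  by rewrite dC ?(ltW t0)// 1?edge_sym// distC.
have edn i j : ~~ edge N i j -> ed t i j = 0 by rewrite /ed /dist_err => /negbTE ->.
have := E2_dissipation (ex t) edC edn; apply: le_trans.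
(* Fixed variables have velocity zero instead of the right-hand side of (E2), but their errors
   vanish, so the products agree. *)
rewrite mulr0 addr0 le_eqVlt; apply/orP; left; apply/eqP; congr (_ + _).
  rewrite mulr_sumr; apply: eq_bigr => i _; rewrite /vx; case: ifP => // ai.
  have := tx i; rewrite ai => xE.
  by rewrite /ex /pos_err xE ?(ltW t0)// subrr !dotp0l.
rewrite mulr_sumr; apply: eq_bigr => i _; rewrite mulr_sumr; apply: eq_bigr => j ij.
have -> : ed t i j * vd t i j = ed t i j * E2_rhs_d N (ex t) (ed t) i j; last by lra.
rewrite /vd; case: ifP => // aij; have := td i j ij; rewrite aij => dE.
by rewrite /ed /dist_err ij dE ?(ltW t0)// subrr !mul0r.
Qed.

Lemma E2_decay (hloc : SA_RoD_localizable N) :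
  exists2 lam : R, 0 < lam & 
    forall (x : 'I_n -> R -> 'cV[R]_2) (d : 'I_n -> 'I_n -> R -> R),
    E2_trajectory N x d ->
    forall t : R, 0 <= t ->
    let bound := 2 * expR (- lam * t) * E2_error N (fun k => x k 0) (fun k l => d k l 0) in
    (forall i, enorm (x i t - pos N i) <= bound) /\
    (forall i j, edge N i j -> `|d i j t - dist N i j| <= bound).
Proof.
have [C C0 coer] := E2_coercive hloc.
(* Coercivity gives [W' <= - W / C] for the energy [W], hence decay at rate [1 / C]; the errors
   themselves, being square roots, decay at half that rate. *)
exists (2 * C)^-1; first by rewrite invr_gt0 mulr_gt0.
move=> x d traj t t0; set E := E2_error _ _ _; move=> bound.
have E0 : 0 <= E.
  by rewrite addr_ge0//; do ?apply: sumr_ge0 => ? _; rewrite ?enorm_ge0.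
have b0 : 0 <= bound by rewrite mulr_ge0// mulr_ge0// expR_ge0.
pose W s := E2_energy (fun k => x k s) (fun k l => d k l s).
pose Y s := \sum_i dotp (pos_err (fun k => x k s) i) (pos_err (fun k => x k s) i)
  + \sum_i \sum_j dist_err (fun k l => d k l s) i j ^+ 2.
have S0 s : 0 <= \sum_i \sum_j dist_err (fun k l => d k l s) i j ^+ 2.
  by do 2!apply: sumr_ge0 => ? _; exact: sqr_ge0.
have Sx s : 0 <= \sum_i dotp (pos_err (fun k => x k s) i) (pos_err (fun k => x k s) i).
  by apply: sumr_ge0 => ? _; exact: dotp_ge0.
have WE s : W s = \sum_i dotp (pos_err (fun k => x k s) i) (pos_err (fun k => x k s) i)
  + 2^-1 * \sum_i \sum_j dist_err (fun k l => d k l s) i j ^+ 2.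
  congr (_ + _ * _); apply: eq_bigr => i _; rewrite big_mkcond.
  by apply: eq_bigr => j _; rewrite /dist_err; case: (edge N i j); rewrite ?expr0n.
have WY s : W s <= Y s by rewrite WE /Y; have := S0 s; lra.
have YW s : Y s <= 2 * W s by rewrite WE /Y; have := Sx s; lra.
have [g ev gle] := E2_energy_evolves traj.
have gW s : 0 < s -> g s <= - (C^-1 * W s).
  move=> s0; apply: le_trans (gle s s0) _; rewrite lerN2 ler_pdivrMl//.
  apply: le_trans (WY s) (coer _ _ _ _) => [i ai|i j nij].
    by case: traj => _ /(_ i) + _; rewrite ai /pos_err => ->; rewrite ?subrr// ltW.
  by rewrite /dist_err (negbTE nij).
have := evolves_nincr (evolvesM ev (evolves_expR C^-1)) _ t0.
rewrite mulr0 expR0 mulr1 -/(W t) -/(W 0) => H.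
have {}H : W t * expR (C^-1 * t) <= E ^+ 2.
  apply: le_trans (H _) (le_trans (WY 0) (E2_error_sqr_ge _ _)) => s s0.
  rewrite -/(W s) [X in X + _]mulrA [X in X + _]mulrC -mulrDr.
  by rewrite pmulr_rle0 ?expR_gt0//; have := gW s s0; lra.
(* The 2 on the left pays for the halved distance terms in [W]; it is absorbed by the factor 4 in
   [bound ^+ 2]. *)
have Wb : 2 * W t <= bound ^+ 2.
  have e2 : expR (- (2 * C)^-1 * t) ^+ 2 = (expR (C^-1 * t))^-1.
    rewrite expr2 -expRD -expRN; congr expR.
    by field; rewrite gt_eqF.
  have : W t <= E ^+ 2 / expR (C^-1 * t) by rewrite ler_pdivlMr ?expR_gt0.
  rewrite /bound !exprMn e2 => H2.
  have := E0; have : 0 <= E ^+ 2 / expR (C^-1 * t) by rewrite divr_ge0 ?sqr_ge0 ?expR_ge0.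
  by move: H2; rewrite (mulrC (E ^+ 2)); lra.
have {}Wb := le_trans (YW t) Wb.
split=> [i|i j ij].
  apply: enorm_le => //; apply: le_trans Wb; rewrite /Y (bigD1 i)//= -addrA lerDl.
  by rewrite addr_ge0//; apply: sumr_ge0 => ? _; exact: dotp_ge0.
rewrite -(ger0_norm b0) -ler_sqr ?nnegrE// !real_normK ?num_real//.
apply: le_trans Wb; rewrite /Y.
have -> : d i j t - dist N i j = dist_err (fun k l => d k l t) i j.
  by rewrite /dist_err ij.
apply: (@le_trans _ _ (\sum_i \sum_j dist_err (fun k l => d k l t) i j ^+ 2)).
  rewrite (bigD1 i)//= (bigD1 j)//= -addrA lerDl.
  by rewrite addr_ge0//; do ?apply: sumr_ge0 => ? _; exact: sqr_ge0.
by rewrite lerDr.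
Qed.

End SecondStage.

Theorem theorem15 (R : realType) (n na : nat) (N : sensor_network R n na)
    (hTA : TA_connected N)
    (hloc : SA_RoD_localizable N)
    (hanchors : exists i j : 'I_n, [/\ anchor na i, anchor na j & edge N i j]) :
  exists C lambda : R, [/\ 0 < C, 0 < lambda,
    (forall b : 'I_n -> 'I_n -> R -> 'cV[R]_2,
      E1_trajectory N b ->
      forall i j : 'I_n, free_node na i -> edge N i j ->
      forall t : R, 0 <= t ->
        enorm (b i j t - bear N i j)
          <= C * expR (- lambda * t) * E1_error N (fun k l => b k l 0)) &
    (forall (x : 'I_n -> R -> 'cV[R]_2) (d : 'I_n -> 'I_n -> R -> R),
      E2_trajectory N x d ->
      (forall i j : 'I_n, edge N i j -> 0 < d i j 0) ->
      forall i : 'I_n, free_node na i ->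
      forall t : R, 0 <= t ->
        enorm (x i t - pos N i)
          <= C * expR (- lambda * t)
             * E2_error N (fun k => x k 0) (fun k l => d k l 0)
        /\ (forall j : 'I_n, edge N i j ->
             `|d i j t - dist N i j|
               <= C * expR (- lambda * t)
                  * E2_error N (fun k => x k 0) (fun k l => d k l 0)))].
Proof.
have [l1 l1_gt0 H1] := E1_decay hTA hanchors.
have [l2 l2_gt0 H2] := E2_decay hloc.
(* Both stages have the factor 2, and the slower rate serves for both because the initial errors are
   nonnegative. *)
exists 2, (Num.min l1 l2).
have mono (l t E : R) : Num.min l1 l2 <= l -> 0 <= t -> 0 <= E ->
    2 * expR (- l * t) * E <= 2 * expR (- Num.min l1 l2 * t) * E.
  move=> ml t0 E0; rewrite ler_wpM2r// ler_pM2l// ler_expR.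
  by rewrite ler_wpM2r// lerN2.
split=> //; first by rewrite lt_min l1_gt0.
  move=> b traj i j _ ij t t0; apply: le_trans (H1 b traj i j ij t t0) (mono _ _ _ _ t0 _).
    by rewrite ge_min lexx.
  by do 2!apply: sumr_ge0 => ? _; exact: enorm_ge0.
move=> x d traj _ i _ t t0; have [Hx Hd] := H2 x d traj t t0.
have E0 : 0 <= E2_error N (fun k => x k 0) (fun k l => d k l 0).
  rewrite addr_ge0//; first by apply: sumr_ge0 => ? _; exact: enorm_ge0.
  by do 2!apply: sumr_ge0 => ? _; exact: normr_ge0.
have l2m : Num.min l1 l2 <= l2 by rewrite ge_min lexx orbT.
have M := mono _ _ _ l2m t0 E0.
split; first exact: le_trans (Hx i) M.
by move=> j ij; exact: le_trans (Hd i j ij) M.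
Qed.
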